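(* Let $(x_n)_{n=1}^{\infty}$ be a moment sequence for which there exist $c > 0$ and $0 < \alpha \leq 1$ such that $$\lim_{n \rightarrow \infty} x_n \cdot n^{\alpha} = c.$$ Then there exists a countable set $X \subset \mathbb{R}$ such that for every $x \in \mathbb{R} \setminus X$ the sequence $(a_n)_{n=0}^{\infty}$ defined by $$a_0 = 0 \qquad \text{and, for } n \geq 1, \qquad a_n = \begin{cases} a_{n-1} + x_n & \text{if } a_{n-1} \leq x,\\ a_{n-1} - x_n & \text{if } a_{n-1} > x,\end{cases}$$ has the following property: for all $k \in \mathbb{N}$ there are infinitely many $n \in \mathbb{N}$ with $$|x - a_n| \leq \frac{1}{n^k}.$$
   Context: A sequence of real numbers $(x_n)_{n=1}^{\infty}$ is called a moment sequence if there is a (nonnegative) Borel measure $\mu$ on $[0,1]$ such that $x_n = \int_0^1 t^n \, d\mu(t)$ (a finite number) for all $n \geq 1$. The measure $\mu$ is not required to have finite total mass; for instance $d\mu = dt/t$ gives $x_n = 1/n$ for $n\ge 1$. ''Countable'' means finite or countably infinite. *)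

(* Defs.v *)
From HB Require Import structures.
From mathcomp Require Import all_boot all_order all_algebra.
From mathcomp Require Import all_classical all_reals all_analysis.

Set Implicit Arguments.
Unset Strict Implicit.
Unset Printing Implicit Defensive.

Import Order.TTheory GRing.Theory Num.Theory.
Import numFieldNormedType.Exports.

Local Open Scope classical_set_scope.
Local Open Scope ring_scope.

(* Sequences (x_n)_{n >= 1} are encoded as functions on nat whose value at 0
   is never used. *)

(* A Borel measure on [0, 1] is given as a Borel measure on the line of which
   only the restriction to [0, 1] matters. It may have infinite mass. *)
Definition moment_sequence (R : realType) (x : nat -> R) : Prop :=
  exists mu : {measure set (measurableTypeR R) -> \bar R},
    forall n : nat, (1 <= n)%N ->
      (x n)%:E = (\int[mu]_(t in `[0%R, 1%R]) (t ^+ n)%:E)%E.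

Fixpoint greedy (R : realType) (x : nat -> R) (y : R) (n : nat) : R :=
  if n is m.+1 then
    if greedy x y m <= y then greedy x y m + x m.+1 else greedy x y m - x m.+1
  else 0.

(* Main.v *)
Require Import Defs.
From HB Require Import structures.
From mathcomp Require Import all_boot all_order all_algebra.
From mathcomp Require Import all_classical all_reals all_analysis.
From mathcomp Require Import ring lra zify.

Set Implicit Arguments.
Unset Strict Implicit.
Unset Printing Implicit Defensive.

Import Order.TTheory GRing.Theory Num.Theory.
Import numFieldNormedType.Exports.

Local Open Scope classical_set_scope.
Local Open Scope ring_scope.

(** The error d n = a n - y obeys d n.+1 = d n -/+ u n with u n = x n.+1, the
    step always pointing to the other side of 0.  As long as the step really
    crosses 0, two consecutive steps change d by u n - u (n + 1) in the
    direction of 0, a move of the same kind with the difference sequence in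
    place of u; crossing again doubles the block length once more.  After k
    doublings the moves are the Thue-Morse signed sums of 2 ^ k consecutive
    terms of u ([thue_morse_sum]), which are O(n ^ -k)
    ([thue_morse_sum_decay]).  It therefore suffices to see that, for every k,
    the error infinitely often lies within one move of level k from 0
    ([captured_infinitely_often]).

    At level 0 this holds because the steps have infinite sum, so that the
    error cannot stay on one side ([captured_often]).  To pass from level k to
    level k + 1, start from an error within one move of level k
    ([walk_descends]).  Every pair of moves of level k shifts the error towards
    0 by one move of level k + 1; either at some point the error is within one
    move of level k + 1, or the moves of level k alternate forever while the
    error tends to 0.  In the second case y = a n -/+ S with S the sum of an
    explicit alternating series depending on k and n only.  As a n takes
    finitely many values for each n, this excludes countably many y.

    For the doubling to be legitimate ([walk_block]), a block of level k + 1
    must start and restart where blocks of level k are available, which asks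
    that a move of level k + 1 be smaller than the following move of level k.
    This is where the moments come in.  A difference of a moment sequence is
    again the moment sequence of a positive functional ([hausdorff_diff]), hence
    is log-convex ([hausdorff_log_convex]); log-convexity propagates to all
    levels the fact that the sequence does not decay geometrically
    ([slow_diff]), and so consecutive moves are asymptotically comparable.  For
    u itself, geometric decay is excluded by the divergence of its sum. *)

(** * Moments of positive functionals *)

(** The Hausdorff moment sequences, described by a positive functional on
    polynomials in place of a measure: multiplying the argument of the
    functional by a polynomial that is nonnegative on [0, 1] replaces the
    passage to a measure with density. *)
Definition hausdorff (R : realType) (u : nat -> R) : Prop :=
  exists L : {poly R} -> R,
    [/\ scalar L,
        forall p, (forall t, 0 <= t <= 1 -> 0 <= p.[t]) -> 0 <= L p &
        forall n, L 'X^n = u n].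

Lemma scalarB (R : realType) (L : {poly R} -> R) (p q : {poly R}) :
  scalar L -> L (p - q) = L p - L q.
Proof.
by move=> linL; rewrite -scaleN1r addrC linL mulN1r addrC.
Qed.

Lemma scalarZ (R : realType) (L : {poly R} -> R) (a : R) (p : {poly R}) :
  scalar L -> L (a *: p) = a * L p.
Proof.
move=> linL.
have L0 : L 0 = 0 by rewrite -(subrr 0) scalarB// subrr.
by rewrite -[a *: p]addr0 linL L0 addr0.
Qed.

(** The factor 1 - t ^ h is nonnegative on [0, 1]. *)
Lemma hausdorff_diff (R : realType) (u : nat -> R) (h : nat) :
  hausdorff u -> hausdorff (fun n => u n - u (n + h)%N).
Proof.
move=> [L [linL L_ge0 LX]]; exists (fun p => L (p * (1 - 'X^h))); split.
- by move=> a p q; rewrite mulrDl -scalerAl linL.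
- move=> p p_ge0; apply: L_ge0 => t t01; rewrite !hornerE mulr_ge0 ?p_ge0//.
  by rewrite subr_ge0 exprn_ile1//; case/andP: t01.
- by move=> n; rewrite mulrBr mulr1 -exprD scalarB// !LX.
Qed.

Lemma hausdorff_ge0 (R : realType) (u : nat -> R) (n : nat) :
  hausdorff u -> 0 <= u n.
Proof.
move=> [L [_ L_ge0 <-]]; apply: L_ge0 => t /andP[t0 _].
by rewrite hornerXn exprn_ge0.
Qed.

Lemma hausdorff_nonincreasing (R : realType) (u : nat -> R) :
  hausdorff u -> {homo u : m n / (m <= n)%N >-> n <= m}.
Proof.
move=> hu m n /subnKC <-; rewrite -subr_ge0.
exact: (hausdorff_ge0 m (hausdorff_diff (n - m) hu)).
Qed.

(** Cauchy-Schwarz: the functional is nonnegative on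
    t ^ n * (u n.+1 - u n * t) ^ 2. *)
Lemma hausdorff_log_convex (R : realType) (u : nat -> R) (n : nat) :
  hausdorff u -> 0 < u n -> u n.+1 ^+ 2 <= u n * u n.+2.
Proof.
move=> [L [linL L_ge0 LX]] un_gt0.
pose p : {poly R} := 'X^n * ((u n.+1)%:P - (u n)%:P * 'X) ^+ 2.
have : 0 <= L p.
  apply: L_ge0 => t /andP[t0 _]; rewrite /p hornerM hornerXn horner_exp.
  by rewrite mulr_ge0 ?sqr_ge0 ?exprn_ge0.
have -> : p = (u n.+1 ^+ 2) *: 'X^n - (2 * u n.+1 * u n) *: 'X^(n.+1)
              - (- (u n ^+ 2)) *: 'X^(n.+2).
  by rewrite /p -!mul_polyC !exprS !(polyCM, polyCN, polyCD, polyC1); ring.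
rewrite !scalarB// !scalarZ// !LX => H.
rewrite -subr_ge0 -(pmulr_rge0 _ un_gt0); move: H.
by congr (0 <= _); ring.
Qed.

(** Along an arithmetic progression the sequence increases to its limit 0. *)
Lemma le0_of_le_shift (R : realType) (D : nat -> R) (h m : nat) :
  (0 < h)%N -> (forall n, D n <= D (n + h)%N) -> D @ \oo --> (0 : R) ->
  D m <= 0.
Proof.
move=> h_gt0 D_le D0; rewrite leNgt; apply/negP => Dm_gt0.
have [N _ DN] := cvgr_lt _ D0 _ Dm_gt0.
have Dmj j : D m <= D (m + j * h)%N.
  elim: j => [|j IHj]; first by rewrite addn0.
  by rewrite (le_trans IHj)// mulSn [(h + _)%N]addnC addnA.
have mN : (N <= m + N * h)%N.
  by rewrite (leq_trans _ (leq_addl _ _))// leq_pmulr.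
by have := lt_le_trans (DN _ mN) (Dmj N); rewrite ltxx.
Qed.

Lemma hausdorff_diff_gt0 (R : realType) (u : nat -> R) (h n : nat) :
  hausdorff u -> u @ \oo --> (0 : R) -> (forall m, 0 < u m) -> (0 < h)%N ->
  0 < u n - u (n + h)%N.
Proof.
move=> hu u0 u_gt0 h_gt0; have hw := hausdorff_diff h hu.
rewrite lt_neqAle (hausdorff_ge0 n hw) andbT; apply/eqP => wn0.
have : u (0 + n)%N <= 0.
  apply: (@le0_of_le_shift _ (fun m => u (m + n)%N) h) => //; last first.
    by rewrite (@cvg_shiftn _ _ u).
  move=> m; rewrite -subr_le0 addnAC wn0 [(m + n)%N]addnC.
  by apply: (hausdorff_nonincreasing hw); rewrite leq_addr.
by rewrite leNgt u_gt0.
Qed.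

(** * Sequences without geometric decay *)

(** Here 2 stands for an arbitrary constant larger than 1; it is the value for
    which consecutive Thue-Morse sums compare as wanted. *)
Definition slow (R : realType) (u : nat -> R) : Prop :=
  forall H, exists N, forall n, (N <= n)%N -> u n < 2 * u (n + H)%N.

(** By log-convexity u (n + H) / u n is nondecreasing in n. *)
Lemma ratio_nondecreasing (R : realType) (u : nat -> R) (H m n : nat) :
  hausdorff u -> (forall i, 0 < u i) -> (m <= n)%N ->
  u n * u (m + H)%N <= u m * u (n + H)%N.
Proof.
move=> hu u_gt0 /subnK <-; elim: (n - m)%N => [|j IHj]; first by rewrite add0n.
have step i : u i.+1 * u (i + H)%N <= u i * u (i.+1 + H)%N.
  elim: H {IHj} => [|H IH]; first by rewrite !addn0 mulrC.
  have lc := hausdorff_log_convex hu (u_gt0 (i + H)%N).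
  rewrite addSn !addnS in IH *; rewrite -(ler_pM2r (u_gt0 (i + H)%N)).
  have := ler_wpM2l (ltW (u_gt0 i)) lc.
  have := ler_wpM2l (ltW (u_gt0 (i + H).+1)) IH.
  lra.
set i := (j + m)%N in IHj *; rewrite addSn -/i.
rewrite -(ler_pM2r (u_gt0 i)).
have := ler_wpM2l (ltW (u_gt0 i.+1)) IHj.
have := ler_wpM2l (ltW (u_gt0 m)) (step i).
lra.
Qed.

(** A ratio u (n + H) / u n that drops to 1 / 2 arbitrarily late was never
    larger, by [ratio_nondecreasing]. *)
Lemma fast_everywhere (R : realType) (u : nat -> R) (H m : nat) :
  hausdorff u -> (forall i, 0 < u i) ->
  ~ (exists N, forall n, (N <= n)%N -> u n < 2 * u (n + H)%N) ->
  2 * u (m + H)%N <= u m.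
Proof.
move=> hu u_gt0 fast.
have /existsNP[n /not_implyP[mn /negP]] := iffRL (forallNP _) fast m.
rewrite -leNgt => fast_n; have := ratio_nondecreasing H hu u_gt0 mn.
have := ler_wpM2l (ltW (u_gt0 m)) fast_n.
by rewrite -[2 * u (m + H)%N <= _](ler_pM2l (u_gt0 n)); lra.
Qed.

(** If the differences w n = u n - u (n + h) decayed geometrically, then
    w (n + H) <= w n / 2 for all n.  Summing along n, n + h, n + 2 h, ... gives
    u (n + H) <= u n / 2, as u tends to 0. *)
Lemma slow_diff (R : realType) (u : nat -> R) (h : nat) :
  hausdorff u -> u @ \oo --> (0 : R) -> (forall m, 0 < u m) -> (0 < h)%N ->
  slow u -> slow (fun n => u n - u (n + h)%N).
Proof.
move=> hu u0 u_gt0 h_gt0 slow_u H; apply: contrapT => fast.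
have fast_all m := fast_everywhere m (hausdorff_diff h hu)
  (fun i => hausdorff_diff_gt0 i hu u0 u_gt0 h_gt0) fast.
have [N /(_ N (leqnn N))] := slow_u H; apply/negP; rewrite -leNgt -subr_le0.
pose D n := 2 * u (n + H)%N - u n.
apply: (@le0_of_le_shift _ D h N) => //.
  by move=> n; have := fast_all n; rewrite /D addnAC; lra.
rewrite -[0 : R](subr0) -[X in _ --> X - _ ](mulr0 2).
by apply: cvgB => //; apply: cvgMr; rewrite (@cvg_shiftn _ _ u).
Qed.

Lemma sum_ord_le (R : realType) (u : nat -> R) (m n : nat) :
  (forall i, 0 <= u i) -> (m <= n)%N -> \sum_(i < m) u i <= \sum_(i < n) u i.
Proof.
move=> u_ge0 /subnKC <-; rewrite big_split_ord/= lerDl.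
by apply: sumr_ge0 => i _.
Qed.

(** Otherwise u (n + H) <= u n / 2 for all n, and the partial sums are bounded
    by twice the sum of the first H terms. *)
Lemma slow_of_divergent (R : realType) (u : nat -> R) :
  hausdorff u -> (forall m, 0 < u m) ->
  (forall M, exists n, M < \sum_(i < n) u i) -> slow u.
Proof.
move=> hu u_gt0 u_dvg H; apply: contrapT => fast.
have half n : 2 * \sum_(i < n + H) u i <=
    2 * \sum_(i < H) u i + \sum_(i < n) u i.
  elim: n => [|n IHn]; first by rewrite big_ord0 addr0.
  rewrite addSn !big_ord_recr/=.
  have := fast_everywhere n hu u_gt0 fast; lra.
have [n] := u_dvg (2 * \sum_(i < H) u i); apply/negP; rewrite -leNgt.
have : \sum_(i < n) u i <= \sum_(i < n + H) u i.
  by apply: sum_ord_le; rewrite ?leq_addr// => i; exact: ltW.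
by have := half n; lra.
Qed.

(** * Thue-Morse sums *)

Definition tame (R : realType) (u : nat -> R) : Prop :=
  [/\ hausdorff u, u @ \oo --> (0 : R), forall n, 0 < u n & slow u].

Lemma tame_diff (R : realType) (u : nat -> R) (h : nat) :
  (0 < h)%N -> tame u -> tame (fun n => u n - u (n + h)%N).
Proof.
move=> h_gt0 [hu u0 u_gt0 slow_u]; split.
- exact: hausdorff_diff.
- by rewrite -[0 : R](subr0); apply: cvgB => //; rewrite (@cvg_shiftn _ _ u).
- by move=> n; exact: hausdorff_diff_gt0.
- exact: slow_diff.
Qed.

(** The sum of u (n + i) over i < 2 ^ k, the sign of the term i being given by
    the parity of the binary digit sum of i. *)
Fixpoint thue_morse_sum (R : realType) (u : nat -> R) (k n : nat) : R :=
  if k is j.+1 then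
    thue_morse_sum u j n - thue_morse_sum u j (n + 2 ^ j)
  else u n.

Lemma tame_thue_morse_sum (R : realType) (u : nat -> R) (k : nat) :
  tame u -> tame (thue_morse_sum u k).
Proof.
move=> tu; elim: k => [//|k IHk].
by apply: tame_diff => //; rewrite expn_gt0.
Qed.

Lemma thue_morse_sum_le (R : realType) (u : nat -> R) (k n : nat) :
  tame u -> thue_morse_sum u k.+1 n <= thue_morse_sum u k n.
Proof.
move=> /(tame_thue_morse_sum k)[_ _ gt0 _] /=.
by rewrite gerBl ltW.
Qed.

(** The left side is at most v n - v (n + 2 ^ k.+1), where v is the sum of
    level k, and v n < 2 * v (n + 2 ^ k.+1) for n large since v is slow. *)
Lemma thue_morse_sum_lt_shift (R : realType) (u : nat -> R) (k : nat) :
  tame u -> exists N, forall n, (N <= n)%N ->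
    thue_morse_sum u k.+1 n < thue_morse_sum u k (n + 2 ^ k.+1).
Proof.
move=> /(tame_thue_morse_sum k)[hv _ _ slow_v].
have [N vN] := slow_v (2 ^ k.+1)%N; exists N => n /vN /=.
have : (n + 2 ^ k <= n + 2 ^ k.+1)%N by rewrite leq_add2l leq_exp2l.
move=> /(hausdorff_nonincreasing hv); lra.
Qed.

(** Differencing gains a factor 1 / n.  The differences w are nonincreasing, so
    of the about n / (2 h) differences which telescope between n / 2 and n the
    last one, w n, is the smallest; their sum is at most u (n / 2). *)
Lemma diff_decay (R : realType) (u : nat -> R) (h j : nat) (C : R) :
  hausdorff u -> (0 < h)%N -> (forall n, u n * n%:R ^+ j <= C) ->
  forall n, (u n - u (n + h)%N) * n%:R ^+ j.+1 <= 4 * h%:R * 2 ^+ j * C.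
Proof.
move=> hu h_gt0 u_le n; pose w n := u n - u (n + h)%N; rewrite -/(w n).
have hw : hausdorff w by exact: hausdorff_diff.
have telescope m J : J%:R * w (m + J * h)%N <= u m - u (m + J * h)%N.
  elim: J => [|J IHJ]; first by rewrite mul0r addn0 subrr.
  have le_w : w (m + J.+1 * h)%N <= w (m + J * h)%N.
    apply: (hausdorff_nonincreasing hw).
    by rewrite leq_add2l leq_mul2r leqnSn orbT.
  have := ler_wpM2l (ler0n R J.+1) le_w.
  rewrite -[J.+1%:R]natr1 {2}/w mulSn [(h + _)%N]addnC addnA in le_w IHJ *.
  by move: IHJ; rewrite /w; lra.
(* m is chosen with n = m + J h and n / 2 <= m. *)
pose J := (n %/ (2 * h))%N; pose m := (n - J * h)%N.
have Jn : (J * (2 * h) <= n)%N by exact: leq_divM.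
have mJ : (m + J * h)%N = n by rewrite subnK//; lia.
have n_le : (n <= 2 * h * J.+1)%N.
  by rewrite ltnW// mulnC -ltn_divLR ?muln_gt0.
have n_le2m : (n <= 2 * m)%N by lia.
have wn_le : n%:R * w n <= 4 * h%:R * u m.
  have := telescope m J; rewrite mJ => tele.
  have : n%:R * w n <= (2 * h * J.+1)%:R * w n.
    by rewrite ler_wpM2r ?ler_nat// hausdorff_ge0.
  move=> /le_trans; apply; rewrite !natrM -natr1.
  have un_ge0 := hausdorff_ge0 n hu.
  have : (J%:R + 1) * w n <= 2 * u m.
    have : w n <= u m.
      rewrite /w (@le_trans _ _ (u n))// ?gerBl ?hausdorff_ge0//.
      by apply: (hausdorff_nonincreasing hu); rewrite leq_subr.
    lra.
  move=> /(ler_wpM2l (ler0n R (2 * h))); rewrite natrM; lra.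
have nj_le : n%:R ^+ j <= 2 ^+ j * m%:R ^+ j :> R.
  by rewrite -exprMn -natrM lerXn2r ?nnegrE ?ler0n// ler_nat.
have um_ge0 := hausdorff_ge0 m hu.
rewrite exprS mulrA [w n * _]mulrC.
apply: le_trans (ler_wpM2r (exprn_ge0 j (ler0n R n)) wn_le) _.
have c_ge0 : 0 <= 4 * h%:R * u m by rewrite !mulr_ge0.
apply: le_trans (ler_wpM2l c_ge0 nj_le) _.
have c'_ge0 : 0 <= 4 * h%:R * 2 ^+ j :> R by rewrite !mulr_ge0// exprn_ge0.
have := ler_wpM2l c'_ge0 (u_le m); lra.
Qed.

Lemma thue_morse_sum_decay (R : realType) (u : nat -> R) (k : nat) :
  tame u -> exists C : R, forall n, thue_morse_sum u k n * n%:R ^+ k <= C.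
Proof.
move=> tu; elim: k => [|k [C leC]].
  exists (u 0%N) => n; rewrite mulr1; case: tu => hu _ _ _.
  exact: (hausdorff_nonincreasing hu).
have [hv _ _ _] := tame_thue_morse_sum k tu.
by eexists; apply: diff_decay leC => //; rewrite expn_gt0.
Qed.

(** * Walks pulled towards 0 *)

(** The move [pull] of size r from d crosses 0.  The asymmetry matches [pull],
    which moves up from 0. *)
Definition captured (R : realType) (r d : R) : bool := - r < d <= r.

Definition pull (R : realType) (d r : R) : R :=
  if d <= 0 then d + r else d - r.

Lemma pullE (R : realType) (d r : R) : pull d r = d - (-1) ^+ (d <= 0)%R * r.
Proof. by rewrite /pull; case: ifP => _; rewrite ?expr1 ?expr0; lra. Qed.

Lemma captured_le (R : realType) (r s d : R) :
  r <= s -> captured r d -> captured s d.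
Proof. by rewrite /captured; lra. Qed.

Lemma captured_norm (R : realType) (r d : R) : captured r d -> `|d| <= r.
Proof. by rewrite /captured ler_norml; lra. Qed.

Lemma pull_flip (R : realType) (r d : R) :
  captured r d -> (pull d r <= 0) = ~~ (d <= 0).
Proof. by rewrite /captured /pull; case: (lerP d 0); lra. Qed.

(** The move of size r crosses 0, so the next one goes back. *)
Lemma pull_pull (R : realType) (r s d : R) :
  captured r d -> pull (pull d r) s = pull d (r - s).
Proof.
move=> dr; rewrite {1}/pull (pull_flip dr) /pull.
by case: (lerP d 0) => _ /=; lra.
Qed.

Lemma captured_pull (R : realType) (r s d : R) :
  r < s -> captured r d -> captured s (pull d r).
Proof. by rewrite /captured /pull; case: (lerP d 0); lra. Qed.

(** After crossing 0 the walker is at distance r - |d|, and |d| >= r - s since d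
    is not captured by r - s. *)
Lemma captured_pull_diff (R : realType) (r s d : R) :
  captured r d -> ~~ captured (r - s) d -> captured s (pull d r).
Proof.
rewrite /captured /pull negb_and -leNgt -ltNge.
by case: (lerP d 0) => d0 /andP[d1 d2] /orP[] d3; lra.
Qed.

(** The move does not cross 0. *)
Lemma norm_pull (R : realType) (r d : R) :
  0 < r -> ~~ captured r d -> `|pull d r| = `|d| - r.
Proof.
rewrite /captured /pull negb_and -leNgt -ltNge => r0 /orP[dr|dr].
  have d0 : d <= 0 by lra.
  by rewrite d0 !ler0_norm//; lra.
have d0 : 0 < d by lra.
by rewrite leNgt d0 /= !ger0_norm; lra.
Qed.

Definition walk (R : realType) (u d : nat -> R) : Prop :=
  forall n, d n.+1 = pull (d n) (u n).

(** The hypothesis at level k.+1 makes the first half of the block cross 0, so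
    that the second half goes back and both combine by [pull_pull].  The
    second half is legitimate at level k because the first one ends within
    thue_morse_sum u k n of 0, which [thue_morse_sum_lt_shift] compares with
    the sum of level k.-1 at the new position. *)
Lemma walk_block (R : realType) (u d : nat -> R) (k : nat) :
  tame u -> walk u d ->
  exists N, forall n, (N <= n)%N ->
    (if k is j.+1 then captured (thue_morse_sum u j n) (d n) else true) ->
    d (n + 2 ^ k)%N = pull (d n) (thue_morse_sum u k n).
Proof.
move=> tu wd; elim: k => [|k [N IHk]].
  by exists 0%N => n _ _; rewrite addn1 wd.
have [N' ltN'] : exists N', forall n, (N' <= n)%N ->
    captured (thue_morse_sum u k n) (d n) ->
    if k is j.+1 then
      captured (thue_morse_sum u j (n + 2 ^ k))
        (pull (d n) (thue_morse_sum u k n)) else true.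
  case: k {IHk} => [|k]; first by exists 0%N.
  have [N' ltN'] := thue_morse_sum_lt_shift k tu.
  by exists N' => n /ltN'; exact: captured_pull.
exists (maxn N N') => n; rewrite geq_max => /andP[Nn N'n] dn.
have step1 : d (n + 2 ^ k)%N = pull (d n) (thue_morse_sum u k n).
  apply: IHk => //; case: k dn {ltN'} => [//|k].
  by apply: captured_le; exact: thue_morse_sum_le.
rewrite expnS mul2n -addnn addnA IHk ?step1 ?pull_pull//.
  by rewrite (leq_trans Nn)// leq_addr.
exact: ltN'.
Qed.

(** As long as level k.+1 does not capture the walker, level k keeps capturing
    it by [captured_pull_diff], and the moves of level k alternate in sign.  If
    this never ends, the walker tends to 0 and the alternating series of all
    these moves sums to the initial position. *)
Lemma walk_descends (R : realType) (u d : nat -> R) (k : nat) :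
  tame u -> walk u d ->
  exists N, forall n, (N <= n)%N -> captured (thue_morse_sum u k n) (d n) ->
    (exists m, (n <= m)%N /\ captured (thue_morse_sum u k.+1 m) (d m)) \/
    (exists s : bool,
      (fun j => \sum_(i < j) (-1) ^+ i * thue_morse_sum u k (n + i * 2 ^ k))
        @ \oo --> (-1) ^+ s * d n).
Proof.
move=> tu wd; have [N block] := walk_block k tu wd.
have [hv v0 v_gt0 _] := tame_thue_morse_sum k tu.
exists N => n Nn dn; set v := thue_morse_sum u k in block hv v0 v_gt0 dn *.
have [|never] := pselect (exists m, (n <= m)%N /\
  captured (thue_morse_sum u k.+1 m) (d m)); first by left.
right; exists (d n <= 0); set h := (2 ^ k)%N in block *.
have inv j : [/\ captured (v (n + j * h)%N) (d (n + j * h)%N),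
    (d (n + j * h)%N <= 0) = odd j (+) (d n <= 0) &
    \sum_(i < j) (-1) ^+ i * v (n + i * h)%N =
      (-1) ^+ (d n <= 0)%R * (d n - d (n + j * h)%N)].
  elim: j => [|j [dm sgn_m sum_m]].
    by rewrite addn0 big_ord0 subrr mulr0.
  rewrite mulSn [(h + _)%N]addnC addnA.
  set m := (n + j * h)%N in dm sgn_m sum_m *.
  have nm : (n <= m)%N by rewrite leq_addr.
  have dmh : d (m + h)%N = pull (d m) (v m).
    apply: block; first exact: leq_trans nm.
    rewrite /v in dm; case: (k) dm => [//|k' dm].
    by apply: captured_le dm; exact: thue_morse_sum_le.
  rewrite dmh; split.
  - apply: captured_pull_diff => //; apply/negP => dm'; apply: never.
    by exists m.
  - by rewrite pull_flip// sgn_m /= addNb.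
  - rewrite big_ord_recr /= sum_m pullE sgn_m signr_addb signr_odd.
    by case: (d n <= 0); rewrite ?expr1 ?expr0; ring.
have -> : (fun j => \sum_(i < j) (-1) ^+ i * v (n + i * h)%N) =
          (fun j => (-1) ^+ (d n <= 0)%R * (d n - d (n + j * h)%N)).
  by apply/funext => j; case: (inv j).
apply: cvgMr; rewrite -[X in _ --> X]subr0; apply: cvgB; first exact: cvg_cst.
apply/norm_cvg0P; apply: (@squeeze_cvgr _ _ _ _ (cst 0) v) => //.
  apply: nearW => j; rewrite normr_ge0 /=; case: (inv j) => dm _ _.
  apply: le_trans (captured_norm dm) _; apply: (hausdorff_nonincreasing hv).
  by rewrite (leq_trans _ (leq_addl _ _))// leq_pmulr// expn_gt0.
exact: cvg_cst.
Qed.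

(** A move that does not cross 0 consumes its length from the distance to 0,
    and infinitely much length is available. *)
Lemma captured_often (R : realType) (u d : nat -> R) :
  (forall n, 0 < u n) -> (forall M, exists n, M < \sum_(i < n) u i) ->
  walk u d ->
  forall N, exists n, (N <= n)%N /\ captured (u n) (d n).
Proof.
move=> u_gt0 u_dvg wd N; apply: contrapT => never.
have out n : (N <= n)%N -> ~~ captured (u n) (d n).
  by move=> Nn; apply/negP => dn; apply: never; exists n.
have budget j : `|d (N + j)%N| + \sum_(i < j) u (N + i)%N = `|d N|.
  elim: j => [|j <-]; first by rewrite addn0 big_ord0 addr0.
  rewrite addnS wd norm_pull ?out ?leq_addr// big_ord_recr /=; ring.
have [n] := u_dvg (\sum_(i < N) u i + `|d N|); apply/negP; rewrite -leNgt.
have sum_le : \sum_(i < n) u i <= \sum_(i < N + n) u i.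
  by apply: sum_ord_le; rewrite ?leq_addl// => i; exact: ltW.
apply: le_trans sum_le _; rewrite big_split_ord/= lerD2l -(budget n).
by rewrite lerDr.
Qed.

(** Induction on the level, starting from [captured_often]; the hypothesis on
    alternating series rules out the second alternative of [walk_descends]. *)
Lemma captured_infinitely_often (R : realType) (u d : nat -> R) :
  tame u -> (forall M, exists n, M < \sum_(i < n) u i) -> walk u d ->
  (forall k n s, ~ (fun j => \sum_(i < j)
      (-1) ^+ i * thue_morse_sum u k (n + i * 2 ^ k)) @ \oo -->
      (-1) ^+ (s : bool) * d n) ->
  forall k N, exists n, (N <= n)%N /\ captured (thue_morse_sum u k n) (d n).
Proof.
move=> tu u_dvg wd nonalt; elim=> [|k IHk] N.
  by case: tu => _ _ u_gt0 _; exact: captured_often.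
have [N' descend] := walk_descends k tu wd.
have [n [Nn dn]] := IHk (maxn N N').
move: Nn; rewrite geq_max => /andP[Nn N'n].
have [[m [nm dm]]|[s alt]] := descend n N'n dn; last by case: (nonalt k n s).
by exists m; split=> //; exact: leq_trans nm.
Qed.

(** * Moment sequences with power decay *)

(** The functional is p |-> the integral of t * p(t).  The factor t is needed
    since the measure may have infinite mass near 0. *)
Lemma moment_hausdorff (R : realType) (x : nat -> R) :
  moment_sequence x -> hausdorff (fun n => x n.+1).
Proof.
move=> [mu xmu]; pose D : set (measurableTypeR R) := `[0, 1]%classic.
have mD : measurable D by exact: measurable_itv.
have int_pow n : mu.-integrable D (EFin \o (fun t : R => t ^+ n.+1)).
  apply/integrableP; split.
    apply/measurable_realfun.measurable_EFinP.
    exact: measurable_realfun.exprn_measurable.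
  under eq_integral => t.
    rewrite inE /D /= in_itv /= => /andP[t0 _].
    rewrite ger0_norm ?exprn_ge0//; over.
  by rewrite -xmu// ltry.
have int_poly (p : {poly R}) n :
    mu.-integrable D (EFin \o (fun t : R => t ^+ n.+1 * p.[t])).
  (* The exponent n is general because the step from p to p 'X + a raises it. *)
  elim/poly_ind: p n => [|p a IHp] n.
    rewrite (_ : _ \o _ = cst 0%E); first exact: integrable0.
    by apply/funext => t /=; rewrite horner0 mulr0.
  pose f (t : R) := t ^+ n.+2 * p.[t]; pose g (t : R) := t ^+ n.+1.
  rewrite (_ : _ \o _ = ((EFin \o f) \+ (fun t => a%:E * (EFin \o g) t))%E).
    apply: integrableD; [exact: mD|exact: IHp|].
    by apply: integrableZl; [exact: mD|exact: int_pow].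
  apply/funext => t /=; rewrite -EFinM -EFinD /f /g; congr EFin.
  rewrite hornerD hornerMX hornerC mulrDr [a * _]mulrC.
  by rewrite [p.[t] * t]mulrC mulrA -exprSr.
pose L (p : {poly R}) := Rintegral mu D (fun t => t ^+ 1 * p.[t]).
exists L; split.
- move=> a p q; rewrite /L -RintegralZl// -RintegralD//; last first.
    exact: (integrableZl mD a (int_poly p 0%N)).
  by apply: eq_Rintegral => t _; rewrite hornerD hornerZ mulrDr mulrCA.
- move=> p p_ge0; apply: Rintegral_ge0 => t; rewrite /D /= in_itv /= => t01.
  by rewrite mulr_ge0 ?p_ge0//; case/andP: t01.
- move=> n; rewrite /L /Rintegral.
  under eq_integral => t _ do rewrite hornerXn -exprD add1n.
  by rewrite -xmu.
Qed.

Lemma riemann_divergent (R : realType) (alpha : R) (M : R) :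
  0 <= alpha <= 1 -> exists n, M < \sum_(i < n) riemannR alpha i.
Proof.
move=> /dvg_riemannR dvg; apply: contrapT => bnd; apply: dvg.
have r_ge0 i : 0 <= riemannR alpha i by rewrite invr_ge0 powR_ge0.
apply: nondecreasing_is_cvgn.
  by apply: nondecreasing_series => i _ _; exact: r_ge0.
exists M => _ [n _ <-]; rewrite /series/= big_mkord leNgt.
by apply/negP => Mn; apply: bnd; exists n.
Qed.

Lemma riemann_cvg0 (R : realType) (alpha : R) :
  0 < alpha -> riemannR alpha @ \oo --> (0 : R).
Proof.
move=> alpha_gt0.
have -> : riemannR alpha = (fun n => harmonic n `^ alpha).
  apply/funext => n; rewrite /riemannR /harmonic/=.
  by rewrite -[n.+1%:R^-1]powR_inv1// -powRrM mulN1r powRN.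
have /cvg_at_rightP := powR_cvg0 alpha_gt0; apply.
split; last exact: cvg_harmonic.
by move=> n; exact: harmonic_gt0.
Qed.

Lemma divergent_of_powR (R : realType) (u : nat -> R) (c alpha : R) :
  0 < c -> 0 <= alpha <= 1 ->
  (fun n => u n * n.+1%:R `^ alpha) @ \oo --> c ->
  forall M, exists n, M < \sum_(i < n) u i.
Proof.
move=> c_gt0 alpha01 uc M; have K_gt0 : 0 < c / 2 by lra.
have cK : c / 2 < c by lra.
have [N _ uN] := cvgr_gt _ uc _ cK.
pose r := riemannR alpha.
have r_ge0 i : 0 <= r i by rewrite invr_ge0 powR_ge0.
have r_le n : (N <= n)%N -> c / 2 * r n <= u n.
  move=> Nn; rewrite /r /riemannR ler_pdivrMr ?powR_gt0//; apply: ltW.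
  exact: uN.
have r_sum n : c / 2 * \sum_(i < N + n) r i <=
    c / 2 * \sum_(i < N) r i + \sum_(i < N + n) u i - \sum_(i < N) u i.
  elim: n => [|n IHn]; first by rewrite addn0; lra.
  rewrite addnS !big_ord_recr/=.
  have := r_le (N + n)%N (leq_addr _ _); lra.
have [n] := riemann_divergent
  ((M + c / 2 * \sum_(i < N) r i - \sum_(i < N) u i) / (c / 2)) alpha01.
rewrite ltr_pdivrMr// => Mn; exists (N + n)%N.
have : \sum_(i < n) r i <= \sum_(i < N + n) r i.
  by apply: sum_ord_le; rewrite ?leq_addl.
by move=> /(ler_wpM2l (ltW K_gt0)); have := r_sum n; rewrite -/r in Mn; lra.
Qed.

Lemma tame_of_powR (R : realType) (x : nat -> R) (c alpha : R) :
  moment_sequence x -> 0 < c -> 0 < alpha <= 1 ->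
  (fun n => x n.+1 * n.+1%:R `^ alpha) @ \oo --> c ->
  tame (fun n => x n.+1).
Proof.
move=> x_moment c_gt0 /andP[alpha_gt0 alpha_le1] xc.
have hu := moment_hausdorff x_moment; set u := fun n => x n.+1 in hu *.
have u_dvg : forall M, exists n, M < \sum_(i < n) u i.
  by apply: divergent_of_powR xc => //; rewrite ltW.
have u_gt0 n : 0 < u n.
  rewrite lt_neqAle (hausdorff_ge0 n hu) andbT; apply/eqP => un0.
  have [m] := u_dvg (\sum_(i < n) u i); apply/negP; rewrite -leNgt.
  have u_ge0 i := hausdorff_ge0 i hu.
  have [mn|/ltnW nm] := leqP m n; first exact: sum_ord_le.
  rewrite -(subnKC nm) big_split_ord /= gerDl sumr_le0// => i _.
  by rewrite un0 (hausdorff_nonincreasing hu)// leq_addr.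
split => //; last exact: slow_of_divergent.
rewrite (_ : u = (fun n => u n * n.+1%:R `^ alpha) \* riemannR alpha).
  by rewrite -(mulr0 c); apply: cvgM => //; exact: riemann_cvg0.
by apply/funext => n /=; rewrite /riemannR mulfK// gt_eqF// powR_gt0.
Qed.

(** * Approximation by the greedy sequence *)

Lemma infinite_of_unbounded (A : set nat) :
  (forall N, exists n, (N <= n)%N /\ A n) -> infinite_set A.
Proof.
move=> unb /finite_seqP[X AX].
have [n [Xn]] := unb (\max_(i <- X) i).+1; rewrite AX /= => nX.
by have := @leq_bigmax_seq _ X predT id n nX isT; rewrite leqNgt Xn.
Qed.

Lemma finite_greedy (R : realType) (x : nat -> R) (n : nat) :
  finite_set [set greedy x y n | y in [set: R]].
Proof.
elim: n => [|n IHn].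
  by apply: sub_finite_set (finite_set1 0) => _ [y _ <-].
apply: (@sub_finite_set _ _ (
  [set a + x n.+1 | a in [set greedy x y n | y in [set: R]]] `|`
  [set a - x n.+1 | a in [set greedy x y n | y in [set: R]]])).
  move=> _ [y _ <-] /=.
  by case: ifP => _; [left | right]; exists (greedy x y n) => //; exists y.
by rewrite finite_setU; split; exact: finite_image.
Qed.

Theorem theorem1 (R : realType) (x : nat -> R)
    (x_moment : moment_sequence x)
    (x_decay : exists c alpha : R,
      [/\ 0 < c, 0 < alpha, alpha <= 1 &
          (fun n : nat => x n * n%:R `^ alpha) @ \oo --> c]) :
  exists X : set R, countable X /\
    forall y : R, ~ X y ->
      forall k : nat,
        infinite_set [set n : nat |
          (1 <= n)%N /\ `|y - greedy x y n| <= 1 / n%:R ^+ k].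
Proof.
have [c [alpha [c_gt0 alpha_gt0 alpha_le1 xc]]] := x_decay.
have {}xc : (fun n => x n.+1 * n.+1%:R `^ alpha) @ \oo --> c.
  by rewrite (@cvg_shiftS _ (fun n => x n * n%:R `^ alpha)).
have tu : tame (fun n => x n.+1).
  by apply: tame_of_powR xc => //; rewrite alpha_gt0.
have u_dvg : forall M, exists n, M < \sum_(i < n) x i.+1.
  by apply: (divergent_of_powR _ _ xc) => //; rewrite alpha_le1 ltW.
set u := fun n => x n.+1 in tu u_dvg.
(* Up to sign, the only error at time n from which the moves of level k can
   alternate forever while the error tends to 0. *)
pose S k n := limn (fun j => \sum_(i < j)
  (-1) ^+ i * thue_morse_sum u k (n + i * 2 ^ k)).
pose X := \bigcup_(q in [set: nat * nat * bool])
  [set a - (-1) ^+ q.2 * S q.1.1 q.1.2 |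
     a in [set greedy x y q.1.2 | y in [set: R]]].
exists X; split.
  apply: bigcup_countable => // q _.
  by apply: finite_set_countable; apply: finite_image; exact: finite_greedy.
move=> y nXy k; pose d n := greedy x y n - y.
have wd : walk u d.
  by move=> n; rewrite /d /pull /= subr_le0; case: ifP => _; rewrite addrAC.
have nonalt k' n (s : bool) : ~ (fun j => \sum_(i < j)
    (-1) ^+ i * thue_morse_sum u k' (n + i * 2 ^ k')) @ \oo -->
    (-1) ^+ s * d n.
  move=> alt; apply: nXy; exists (k', n, s) => //=.
  exists (greedy x y n); first by exists y.
  by rewrite /S (cvg_lim _ alt)// signrMK /d subKr.
have often := captured_infinitely_often tu u_dvg wd nonalt k.+1.
have [C decay] := thue_morse_sum_decay k.+1 tu.
apply: infinite_of_unbounded => N.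
(* One level more than k: for n >= C the extra factor 1 / n absorbs C. *)
have [n [Nn dn]] := often (maxn N (maxn 1 (Num.truncn C).+1)).
move: Nn; rewrite !geq_max => /and3P[Nn n_gt0 Cn].
exists n; split=> //; split=> //.
have nR_gt0 : 0 < n%:R :> R by rewrite ltr0n.
rewrite ler_pdivlMr ?exprn_gt0// distrC -(ler_pM2r nR_gt0) mul1r.
have C_le : C <= n%:R.
  by rewrite ltW// (lt_le_trans (truncnS_gt C))// ler_nat.
apply: le_trans C_le; apply: le_trans (decay n).
by rewrite exprSr mulrA !ler_wpM2r ?exprn_ge0// captured_norm.
Qed.
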